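(* Let $q>0$ and let $n\in\mathbb{N}$ be fixed. Let $\tilde L_{n,q}:C[0,1]\to C[0,1]$ be the nonlinear $q$-analogue Bernstein operator $$(\tilde L_{n,q}\phi)(a)=\sum_{i=0}^n\left|\phi\!\left(\frac{[i]_q}{[n]_q}\right)\right| b_{n,i}(q,a),\qquad a\in[0,1].$$ Then for each $\varphi\in C[0,1]$ the limit $\lim_{j\to\infty}\tilde L_{n,q}^{\,j}\varphi$ exists and $$\lim_{j\to\infty}\tilde L_{n,q}^{\,j}\varphi\in\{\varphi^*\in C[0,1]:\tilde L_{n,q}\varphi^*=\varphi^*\}.$$ Furthermore, for each $\varphi\in W'=\{\varsigma\in C[0,1]:\varsigma(0)\ge 0\text{ and }\varsigma(1)\ge 0\}$, $$\lim_{j\to\infty}(\tilde L_{n,q}^{\,j}\varphi)(a)=\varphi(0)(1-a)+\varphi(1)a,\qquad 0\le a\le 1.$$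
   Context: $C[0,1]$ is the space of continuous real-valued functions on $[0,1]$ with the supremum norm, and $\tilde L_{n,q}^{\,j}$ is the $j$-fold iterate of $\tilde L_{n,q}$. The $q$-integers are $[0]_q=0$ and $[i]_q=\sum_{k=0}^{i-1}q^k$ for $i\ge1$; the $q$-factorials are $[0]_q!=1$ and $[n]_q!=\prod_{i=1}^n[i]_q$; the $q$-binomial coefficients are $\binom{n}{i}_q=\frac{[n]_q!}{[n-i]_q!\,[i]_q!}$. For $0\le i\le n$ and $a\in[0,1]$, $$b_{n,i}(q,a)=\frac{\binom{n}{i}_q\,q^{i(i-1)/2}\,a^i(1-a)^{n-i}}{\prod_{j=0}^{n-1}\{1-a+q^ja\}},$$ with the convention $0^0=1$. *)

(* Defs.v *)
From HB Require Import structures.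
From mathcomp Require Import all_boot all_order all_algebra.
From mathcomp Require Import all_classical all_reals all_analysis.

Set Implicit Arguments.
Unset Strict Implicit.
Unset Printing Implicit Defensive.

Import Order.TTheory GRing.Theory Num.Theory.
Import numFieldNormedType.Exports.

Local Open Scope classical_set_scope.
Local Open Scope ring_scope.

Definition I01 (R : realType) : set R := `[0%R, 1%R]%classic.
Arguments I01 R : clear implicits.

Lemma in_I01 (R : realType) (x : R) : 0 <= x -> x <= 1 -> x \in I01 R.
Proof.
by move=> x0 x1; rewrite inE /I01 /= in_itv /= x0 x1.
Qed.

Lemma I01_ge0 (R : realType) (a : I01 R) : 0 <= \val a.
Proof. by have := set_valP a; rewrite /I01 /= in_itv /= => /andP[]. Qed.

Lemma I01_le1 (R : realType) (a : I01 R) : \val a <= 1.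
Proof. by have := set_valP a; rewrite /I01 /= in_itv /= => /andP[]. Qed.

Definition zero01 (R : realType) : I01 R := SigSub (in_I01 (lexx 0) ler01).
Definition one01 (R : realType) : I01 R := SigSub (in_I01 ler01 (lexx 1)).
Arguments zero01 {R}.
Arguments one01 {R}.

(* C[0,1], with the supremum norm.  The alias keeps this topology apart from
   the other topologies the library puts on [continuousType]. *)
Definition C01 (R : realType) : Type := continuousType (I01 R) R.

Section C01_normed.
Variable R : realType.
Implicit Types f g h : C01 R.

HB.instance Definition _ := gen_eqMixin (C01 R).
HB.instance Definition _ := gen_choiceMixin (C01 R).

Definition mkC01 (f : I01 R -> R) (cf : continuous f) : C01 R := mkcts cf.

Lemma C01P f g : f =1 g -> f = g.
Proof. by move=> fg; apply/continuousEP. Qed.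

Lemma C01_continuous f : continuous f.
Proof. exact: cts_fun. Qed.

Lemma addC01_subproof f g : continuous (fun a : I01 R => f a + g a).
Proof. by move=> a; exact: (cvgD (@C01_continuous f a) (@C01_continuous g a)). Qed.
Lemma oppC01_subproof f : continuous (fun a : I01 R => - f a).
Proof. by move=> a; exact: (cvgN (@C01_continuous f a)). Qed.
Lemma zeroC01_subproof : continuous (fun _ : I01 R => 0 : R).
Proof. exact: cst_continuous. Qed.
Lemma scaleC01_subproof (c : R) f : continuous (fun a : I01 R => c * f a).
Proof. by move=> a; exact: (cvgMl_tmp (@C01_continuous f a)). Qed.

Definition addC01 f g := mkC01 (@addC01_subproof f g).
Definition oppC01 f := mkC01 (@oppC01_subproof f).
Definition zeroC01 := mkC01 (@zeroC01_subproof).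
Definition scaleC01 (c : R) f := mkC01 (@scaleC01_subproof c f).

Lemma addC01A : associative addC01.
Proof. by move=> f g h; apply: C01P => a; exact: addrA. Qed.
Lemma addC01C : commutative addC01.
Proof. by move=> f g; apply: C01P => a; exact: addrC. Qed.
Lemma add0C01 : left_id zeroC01 addC01.
Proof. by move=> f; apply: C01P => a; exact: add0r. Qed.
Lemma addNC01 : left_inverse zeroC01 oppC01 addC01.
Proof. by move=> f; apply: C01P => a; exact: addNr. Qed.

HB.instance Definition _ :=
  GRing.isZmodule.Build (C01 R) addC01A addC01C add0C01 addNC01.

Lemma scaleC01A (c d : R) f : scaleC01 c (scaleC01 d f) = scaleC01 (c * d) f.
Proof. by apply: C01P => a; exact: mulrA. Qed.
Lemma scale1C01 : left_id 1 scaleC01.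
Proof. by move=> f; apply: C01P => a; exact: mul1r. Qed.
Lemma scaleC01Dr : right_distributive scaleC01 +%R.
Proof. by move=> c f g; apply: C01P => a; exact: mulrDr. Qed.
Lemma scaleC01Dl f : {morph scaleC01^~ f : c d / c + d}.
Proof. by move=> c d; apply: C01P => a; exact: mulrDl. Qed.

HB.instance Definition _ := GRing.Zmodule_isLmodule.Build R (C01 R)
  scaleC01A scale1C01 scaleC01Dr scaleC01Dl.

Lemma C01_addE f g a : (f + g) a = f a + g a. Proof. by []. Qed.
Lemma C01_oppE f a : (- f) a = - f a. Proof. by []. Qed.
Lemma C01_zeroE a : (0 : C01 R) a = 0. Proof. by []. Qed.
Lemma C01_scaleE (c : R) f a : (c *: f) a = c * f a. Proof. by []. Qed.

Definition supnorm f : R := sup [set `|f a| | a in [set: I01 R]].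

Lemma has_ubound_C01 f : has_ubound [set `|f a| | a in [set: I01 R]].
Proof.
have cf : continuous (fun a : I01 R => `|f a|).
  by move=> a; exact: (cvg_norm (@C01_continuous f a)).
have cF : {within `[0, 1], continuous (valL_ 0 (fun a : I01 R => `|f a|))}.
  exact/subspace_valL_continuousP'.
have valLE (g : I01 R -> R) a : valL_ 0 g (\val a) = g a.
  exact: (congr1 (fun h : I01 R -> R => h a) (valLK 0 g)).
have [c _ cmax] := EVT_max ler01 cF.
exists (valL_ 0 (fun a : I01 R => `|f a|) c) => _ [a _ <-].
rewrite -(valLE (fun a => `|f a|)); apply: cmax.
by rewrite in_itv /= I01_ge0 I01_le1.
Qed.

Lemma supnorm_ge f a : `|f a| <= supnorm f.
Proof. by apply: (ub_le_sup (has_ubound_C01 f)); exists a. Qed.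

Lemma supnorm_le f (M : R) : (forall a, `|f a| <= M) -> supnorm f <= M.
Proof.
by move=> fM; apply: ge_sup => [|_ [a _ <-]//]; exists `|f zero01|; exists zero01.
Qed.

Lemma supnormD f g : supnorm (f + g) <= supnorm f + supnorm g.
Proof.
apply: supnorm_le => a; rewrite C01_addE (le_trans (ler_normD _ _))//.
by rewrite lerD// supnorm_ge.
Qed.

Lemma supnormZ (c : R) f : supnorm (c *: f) = `|c| * supnorm f.
Proof.
have le d h : supnorm (d *: h) <= `|d| * supnorm h.
  apply: supnorm_le => a; rewrite C01_scaleE normrM.
  by rewrite ler_wpM2l// supnorm_ge.
apply/eqP; rewrite eq_le le /=; have [->|c0] := eqVneq c 0.
  by rewrite normr0 mul0r (le_trans (normr_ge0 _) (supnorm_ge _ zero01)).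
have := le c^-1 (c *: f); rewrite scalerA mulVf// scale1r normfV.
by rewrite ler_pdivlMl ?normr_gt0.
Qed.

Lemma supnorm0_eq0 f : supnorm f = 0 -> f = 0.
Proof.
move=> f0; apply: C01P => a; apply/normr0_eq0/eqP.
by rewrite eq_le normr_ge0 -f0 supnorm_ge.
Qed.

HB.instance Definition _ := Lmodule_isNormed.Build R (C01 R)
  supnormD supnormZ supnorm0_eq0.

Lemma C01_normE f : `|f| = sup [set `|f a| | a in [set: I01 R]].
Proof. by []. Qed.

End C01_normed.

Section q_calculus.
Variable R : realType.
Implicit Types (q : R) (n i : nat).

Definition qint q i : R := \sum_(k < i) q ^+ k.
Definition qfact q n : R := \prod_(1 <= i < n.+1) qint q i.
Definition qbinom q n i : R := qfact q n / (qfact q (n - i) * qfact q i).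

(* [0 ^+ 0 = 1] in MathComp, as required at [a = 0] and [a = 1]. *)
Definition qbern q n i (a : R) : R :=
  qbinom q n i * q ^+ (i * (i - 1) %/ 2) * a ^+ i * (1 - a) ^+ (n - i)
    / \prod_(j < n) (1 - a + q ^+ j * a).

Lemma qint_ge0 q i : 0 < q -> 0 <= qint q i.
Proof. by move=> q0; apply: sumr_ge0 => k _; rewrite exprn_ge0// ltW. Qed.

Lemma qint_le q i n : 0 < q -> (i <= n)%N -> qint q i <= qint q n.
Proof.
move=> q0 /subnKC <-; rewrite /qint big_split_ord /= lerDl.
by apply: sumr_ge0 => k _; rewrite exprn_ge0// ltW.
Qed.

Lemma qnode_subproof q n (i : 'I_n.+1) : 0 < q -> qint q i / qint q n \in I01 R.
Proof.
move=> q0; apply: in_I01; first by rewrite divr_ge0 ?qint_ge0.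
have := qint_ge0 n q0; rewrite le_eqVlt => /predU1P[<-|n0].
  by rewrite invr0 mulr0.
by rewrite ler_pdivrMr// mul1r qint_le// -ltnS.
Qed.

Definition qnode q (q0 : 0 < q) n (i : 'I_n.+1) : I01 R :=
  SigSub (qnode_subproof i q0).

Lemma qden_neq0 q n (a : I01 R) : 0 < q ->
  \prod_(j < n) (1 - \val a + q ^+ j * \val a) != 0.
Proof.
move=> q0; apply/prodf_neq0 => j _; rewrite gt_eqF//.
have [a0|a0] := eqVneq (\val a) 0; first by rewrite a0 subr0 mulr0 addr0.
rewrite ltr_wpDl ?subr_ge0 ?I01_le1// mulr_gt0 ?exprn_gt0//.
by rewrite lt_neqAle eq_sym a0 I01_ge0.
Qed.

Section continuity.
Variable T : topologicalType.
Implicit Types f g : T -> R.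

Lemma continuous_add f g : continuous f -> continuous g ->
  continuous (fun a => f a + g a).
Proof. by move=> cf cg a; exact: cvgD (cf a) (cg a). Qed.

Lemma continuous_sub f g : continuous f -> continuous g ->
  continuous (fun a => f a - g a).
Proof. by move=> cf cg a; exact: cvgB (cf a) (cg a). Qed.

Lemma continuous_mul f g : continuous f -> continuous g ->
  continuous (fun a => f a * g a).
Proof. by move=> cf cg a; exact: cvgM (cf a) (cg a). Qed.

Lemma continuous_div f g : continuous f -> continuous g ->
  (forall a, g a != 0) -> continuous (fun a => f a / g a).
Proof. by move=> cf cg g0 a; exact: cvgM (cf a) (cvgV (g0 a) (cg a)). Qed.

Lemma continuous_exprn f n : continuous f -> continuous (fun a => f a ^+ n).
Proof.
by move=> cf a; exact: (cvg_comp _ _ (cf a) (@exprn_continuous R n (f a))).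
Qed.

Lemma continuous_sum n (f : 'I_n -> T -> R) : (forall k, continuous (f k)) ->
  continuous (fun a => \sum_(k < n) f k a).
Proof. by move=> cf; apply: continuous_big => // -[x y]; exact: add_continuous. Qed.

Lemma continuous_prod n (f : 'I_n -> T -> R) : (forall k, continuous (f k)) ->
  continuous (fun a => \prod_(k < n) f k a).
Proof. by move=> cf; apply: continuous_big => // -[x y]; exact: mul_continuous. Qed.

End continuity.

Lemma qbern_continuous q n i : 0 < q ->
  continuous (fun a : I01 R => qbern q n i (\val a)).
Proof.
move=> q0.
have cv : continuous (fun a : I01 R => \val a : R) by exact: initial_continuous.
have c1v : continuous (fun a : I01 R => 1 - \val a : R).
  exact: (continuous_sub (@cst_continuous (I01 R) R 1) cv).
apply: continuous_div; last by move=> a; exact: qden_neq0.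
  apply: continuous_mul; last exact: continuous_exprn.
  apply: continuous_mul; last exact: continuous_exprn.
  exact: cst_continuous.
apply: continuous_prod => j; apply: continuous_add => //.
by apply: continuous_mul => //; exact: cst_continuous.
Qed.

Lemma nlbern_subproof q (q0 : 0 < q) n (phi : C01 R) :
  continuous (fun a : I01 R =>
    \sum_(i < n.+1) `|phi (qnode q0 i)| * qbern q n i (\val a)).
Proof.
apply: continuous_sum => i; apply: continuous_mul; first exact: cst_continuous.
exact: qbern_continuous.
Qed.

Definition nlbern q (q0 : 0 < q) n (phi : C01 R) : C01 R :=
  mkC01 (@nlbern_subproof q q0 n phi).

End q_calculus.

Definition nonneg_ends (R : realType) : set (C01 R) :=
  [set phi | 0 <= phi zero01 /\ 0 <= phi one01].

(* Main.v *)
(** On functions with nonnegative endpoint values the operator fixes these two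
    values, and it fixes every nonnegative affine function, because the [qbern]
    are nonnegative, sum to [1] and have first moment [a].  If [l] is the affine
    interpolant of [phi] at the endpoints, the nodes [0] and [1] contribute
    nothing to [L phi - l], so that
    [|L phi - l| <= sup_a (1 - b_0 a - b_n a) * |phi - l|].  As [b_0 + b_n] is
    bounded below by a positive constant, the iterates converge geometrically
    to [l].  For arbitrary [phi], [L phi] already has nonnegative endpoint
    values. *)

Require Import Defs.
From HB Require Import structures.
From mathcomp Require Import all_boot all_order all_algebra.
From mathcomp Require Import all_classical all_reals all_analysis.
From mathcomp Require Import ring lra.

Set Implicit Arguments.
Unset Strict Implicit.
Unset Printing Implicit Defensive.

Import Order.TTheory GRing.Theory Num.Theory.
Import numFieldNormedType.Exports.

Local Open Scope classical_set_scope.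
Local Open Scope ring_scope.

(** * Identities for $q$-binomials and moments of the basis [qbern] *)

Section q_identities.
Variables (R : realType) (q : R).
Hypothesis q_gt0 : 0 < q.

Lemma qint_gt0 i : (0 < i)%N -> 0 < qint q i.
Proof.
case: i => // i _; rewrite /qint big_ord_recl expr0 ltr_pwDl//.
by apply: sumr_ge0 => k _; rewrite exprn_ge0// ltW.
Qed.

Lemma qintD m k : qint q (m + k) = qint q m + q ^+ m * qint q k.
Proof.
rewrite /qint big_split_ord /= mulr_sumr; congr (_ + _).
by apply: eq_bigr => i _; rewrite exprD.
Qed.

Lemma qfact_gt0 n : 0 < qfact q n.
Proof.
rewrite /qfact big_seq; apply: prodr_gt0 => i.
by rewrite mem_index_iota => /andP[i0 _]; exact: qint_gt0.
Qed.

Lemma qfactS n : qfact q n.+1 = qfact q n * qint q n.+1.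
Proof. by rewrite /qfact big_nat_recr. Qed.

Lemma qfact0 : qfact q 0 = 1.
Proof. by rewrite /qfact big_nil. Qed.

Lemma qbinom0 n : qbinom q n 0 = 1.
Proof. by rewrite /qbinom subn0 qfact0 mulr1 divff// gt_eqF ?qfact_gt0. Qed.

Lemma qbinomnn n : qbinom q n n = 1.
Proof. by rewrite /qbinom subnn qfact0 mul1r divff// gt_eqF ?qfact_gt0. Qed.

Lemma qbinom_ge0 n i : 0 <= qbinom q n i.
Proof. by rewrite /qbinom divr_ge0 ?mulr_ge0// ltW ?qfact_gt0. Qed.

(* The bound on [i] matters: truncated subtraction makes [qbinom q n n.+1]
   nonzero. *)
Lemma qbinomS n i : (i < n)%N ->
  qbinom q n.+1 i.+1 = qbinom q n i.+1 + q ^+ (n - i) * qbinom q n i.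
Proof.
move=> /subnKC <-; set k := (n - i.+1)%N.
have -> : (i.+1 + k - i = k.+1)%N by rewrite addSnnS addKn.
rewrite /qbinom.
have -> : ((i.+1 + k).+1 - i.+1 = k.+1)%N by rewrite -addnS addKn.
have -> : (i.+1 + k - i.+1 = k)%N by rewrite addKn.
have -> : (i.+1 + k - i = k.+1)%N by rewrite addSnnS addKn.
rewrite (qfactS (i.+1 + k)) (qfactS k) (qfactS i).
(* With [n = i.+1 + k], this splitting of a $q$-integer carries the whole rule; the rest is
   cancellation of factorials. *)
have -> : qint q (i.+1 + k).+1 = qint q k.+1 + q ^+ k.+1 * qint q i.+1.
  by rewrite -qintD (addnC k.+1) addnS.
field.
by rewrite ?gt_eqF ?qfact_gt0 ?qint_gt0.
Qed.

(** Absorption identity: it lowers the order by one when the first moment is computed. *)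
Lemma qint_qbinom n i :
  qint q i.+1 / qint q n.+1 * qbinom q n.+1 i.+1 = qbinom q n i.
Proof.
rewrite /qbinom subSS !qfactS; field.
by rewrite !gt_eqF ?qfact_gt0 ?qint_gt0.
Qed.

Lemma triangularS i : (i.+1 * (i.+1 - 1) %/ 2 = i * (i - 1) %/ 2 + i)%N.
Proof. by rewrite !divn2 !subn1 -!bin2 binS bin1 addnC. Qed.

(** Induction on [n] through the Pascal rule [qbinomS]. At [x = 1 - a], [y = a] it says that the
    numerators of [qbern] add up to its denominator. *)
Lemma q_binomial_theorem n (x y : R) :
  \prod_(j < n) (x + q ^+ j * y) =
  \sum_(i < n.+1) qbinom q n i * q ^+ (i * (i - 1) %/ 2) * y ^+ i * x ^+ (n - i).
Proof.
elim: n => [|n IHn].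
  by rewrite big_ord0 big_ord_recl big_ord0 qbinom0 /= !expr0 !mulr1 addr0.
rewrite big_ord_recr /= IHn mulrDr [LHS]addrC.
(* The sum multiplied by [q ^+ n * y] gives up its last term, the one multiplied by [x] its first.
   These are the extreme terms of the right-hand side; the others pair off by [qbinomS]. *)
rewrite [in X in X + _]big_ord_recr [in X in _ + X]big_ord_recl.
rewrite [RHS]big_ord_recl [in RHS]big_ord_recr /= /bump /= !add1n.
rewrite !qbinom0 !qbinomnn !subnn !subn0 triangularS /= exprD !exprS.
rewrite !expr0 !mulrDl.
set S1 := (\sum_(i < n) _) * _; set S2 := (\sum_(i < n) _) * _.
set S3 := \sum_(i < n) _.
suff -> : S3 = S1 + S2 by ring.
rewrite /S1 /S2 /S3 !mulr_suml -big_split /=; apply: eq_bigr => i _.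
rewrite add1n qbinomS// triangularS subSS.
have -> : (n - i = (n - i.+1).+1)%N by rewrite subnSK.
have -> : q ^+ n = q ^+ i * q ^+ (n - i.+1).+1.
  by rewrite -exprD subnSK// subnKC// ltnW.
by rewrite !exprD !exprS; ring.
Qed.

Lemma qden_gt0 n (a : I01 R) : 0 < \prod_(j < n) (1 - \val a + q ^+ j * \val a).
Proof.
rewrite lt_neqAle eq_sym qden_neq0//=; apply: prodr_ge0 => j _.
by rewrite addr_ge0 ?subr_ge0 ?I01_le1// mulr_ge0 ?I01_ge0// exprn_ge0// ltW.
Qed.

Lemma qbern_ge0 n i (a : I01 R) : 0 <= qbern q n i (\val a).
Proof.
have [a0 a1] := (I01_ge0 a, I01_le1 a).
rewrite /qbern divr_ge0 ?(ltW (qden_gt0 _ _))//.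
rewrite mulr_ge0 ?exprn_ge0 ?subr_ge0// mulr_ge0 ?exprn_ge0//.
by rewrite mulr_ge0 ?qbinom_ge0// exprn_ge0// ltW.
Qed.

Lemma sum_qbern n (a : I01 R) : \sum_(i < n.+1) qbern q n i (\val a) = 1.
Proof. by rewrite /qbern -mulr_suml -q_binomial_theorem divff// qden_neq0. Qed.

(** By absorption, the numerators add up to [a] times the $q$-binomial expansion of order [n] at
    [y = q * a]. *)
Lemma sum_qnode_qbern n (a : I01 R) :
  \sum_(i < n.+2) qint q i / qint q n.+1 * qbern q n.+1 i (\val a) = \val a.
Proof.
rewrite big_ord_recl /= {1}/qint big_ord0 !mul0r add0r.
have den0 := qden_neq0 n.+1 a q_gt0.
under eq_bigr do rewrite /qbern mulrA.
rewrite -mulr_suml; apply: (canLR (mulfK den0)).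
(* The factor [j = 0] of the denominator is [1]; the others are the
   denominator of order [n] at [q * a]. *)
rewrite big_ord_recl expr0 mul1r subrK mul1r.
under [in RHS]eq_bigr do rewrite /bump /= exprS [q * _]mulrC -mulrA.
rewrite q_binomial_theorem mulr_sumr; apply: eq_bigr => i _.
rewrite /bump /= add1n -(qint_qbinom n i) triangularS subSS exprD exprMn exprS.
ring.
Qed.

Lemma qbern0E n a : qbern q n 0 a =
  (1 - a) ^+ n / \prod_(j < n) (1 - a + q ^+ j * a).
Proof. by rewrite /qbern qbinom0 mul0n div0n subn0 !expr0 !mul1r. Qed.

Lemma qbernnE n a : qbern q n n a =
  q ^+ (n * (n - 1) %/ 2) * a ^+ n / \prod_(j < n) (1 - a + q ^+ j * a).
Proof. by rewrite /qbern qbinomnn subnn expr0 !mul1r mulr1. Qed.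

(** Factor by factor, the denominator is at most [M]. One of [a] and [1 - a] is at least 1/2, so one
    of the two numerators is at least [m * 2^-1 ^+ n], [m] being the smaller of their
    coefficients. *)
Lemma qbern_ends_bound n : exists2 c : R, 0 < c &
  forall a : I01 R, c <= qbern q n 0 (\val a) + qbern q n n (\val a).
Proof.
pose M : R := \prod_(j < n) (1 + q ^+ j).
pose m : R := Num.min 1 (q ^+ (n * (n - 1) %/ 2)).
have M0 : 0 < M by apply: prodr_gt0 => j _; rewrite ltr_pwDl// exprn_ge0// ltW.
have m0 : 0 < m by rewrite lt_min ltr01 exprn_gt0.
exists (m * 2^-1 ^+ n / M).
  by rewrite !divr_gt0// mulr_gt0// exprn_gt0// invr_gt0.
move=> a; have a0 := I01_ge0 a; have a1 := I01_le1 a.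
have D0 := qden_gt0 n a.
rewrite qbern0E qbernnE -mulrDl; apply: ler_pM.
- by rewrite mulr_ge0 ?exprn_ge0 ?invr_ge0// ltW.
- by rewrite invr_ge0 ltW.
- have h0 : (0 : R) <= 2^-1 by rewrite invr_ge0.
  have u0 : 0 <= (1 - \val a) ^+ n by rewrite exprn_ge0// subr_ge0.
  have v0 : 0 <= (\val a) ^+ n by rewrite exprn_ge0.
  have m1 : m <= 1 by rewrite ge_min lexx.
  have mq : m <= q ^+ (n * (n - 1) %/ 2) by rewrite ge_min lexx orbT.
  have [ha|ha] := leP (\val a) 2^-1.
    rewrite -[X in X <= _]addr0 lerD//; last by rewrite mulr_ge0// exprn_ge0// ltW.
    rewrite -[leRHS]mul1r ler_pM ?exprn_ge0 ?(ltW m0)//.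
    by rewrite lerXn2r ?nnegrE ?subr_ge0//; lra.
  rewrite -[X in X <= _]add0r lerD// ler_pM ?exprn_ge0 ?(ltW m0)//.
  by rewrite lerXn2r ?nnegrE// ltW.
- rewrite lef_pV2// ?posrE//; apply: ler_prod => j _.
  have qj0 : 0 <= q ^+ j by rewrite exprn_ge0// ltW.
  rewrite addr_ge0 ?subr_ge0 ?mulr_ge0//=.
  by rewrite lerD ?gerBl// ler_piMr.
Qed.

End q_identities.

(** * Affine interpolation at the endpoints *)

Section endpoint_line.
Variable R : realType.
Implicit Types phi psi : C01 R.

Lemma endpoint_line_continuous phi :
  continuous (fun a : I01 R => phi zero01 * (1 - \val a) + phi one01 * \val a).
Proof.
have cv : continuous (fun a : I01 R => \val a : R) by exact: initial_continuous.
apply: continuous_add; apply: continuous_mul => //; try exact: cst_continuous.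
by apply: continuous_sub => //; exact: cst_continuous.
Qed.

Definition endpoint_line phi : C01 R := mkC01 (@endpoint_line_continuous phi).

Lemma endpoint_lineE phi a :
  endpoint_line phi a = phi zero01 * (1 - \val a) + phi one01 * \val a.
Proof. by []. Qed.

Lemma endpoint_line_ge0 phi a : nonneg_ends phi -> 0 <= endpoint_line phi a.
Proof.
by move=> [p0 p1]; rewrite endpoint_lineE addr_ge0// mulr_ge0 ?subr_ge0 ?I01_ge0 ?I01_le1.
Qed.

Lemma endpoint_line_zero phi : endpoint_line phi zero01 = phi zero01.
Proof.
by rewrite endpoint_lineE/= subr0 mulr0 mulr1 addr0.
Qed.

Lemma endpoint_line_one phi : endpoint_line phi one01 = phi one01.
Proof.
by rewrite endpoint_lineE/= subrr mulr0 mulr1 add0r.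
Qed.

Lemma eq_endpoint_line phi psi : phi zero01 = psi zero01 ->
  phi one01 = psi one01 -> endpoint_line phi = endpoint_line psi.
Proof. by move=> e0 e1; apply: C01P => a; rewrite !endpoint_lineE e0 e1. Qed.

End endpoint_line.

(** * Contraction towards the interpolant and convergence of the iterates *)

Section nlbern_iterates.
Variables (R : realType) (q : R) (q_gt0 : 0 < q) (n : nat).
Implicit Type phi : C01 R.
Local Notation L := (nlbern q_gt0 n.+1).

Lemma qnode0 : qnode q_gt0 (ord0 : 'I_n.+2) = zero01.
Proof. by apply: val_inj; rewrite /= /qint big_ord0 mul0r. Qed.

Lemma qnode_max : qnode q_gt0 (ord_max : 'I_n.+2) = one01.
Proof. by apply: val_inj; rewrite /= divff// gt_eqF// qint_gt0. Qed.

Lemma nlbernE phi a : L phi a =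
  \sum_(i < n.+2) `|phi (qnode q_gt0 i)| * qbern q n.+1 i (\val a).
Proof. by []. Qed.

(** The basis reproduces affine functions of either sign, so the line can be brought under the sum,
    without absolute value. *)
Lemma nlbern_endpoint_line_sub phi a : L phi a - endpoint_line phi a =
  \sum_(i < n.+2) (`|phi (qnode q_gt0 i)| - endpoint_line phi (qnode q_gt0 i))
                    * qbern q n.+1 i (\val a).
Proof.
rewrite nlbernE; under [RHS]eq_bigr do rewrite mulrBl.
rewrite [RHS]big_split /= sumrN; congr (_ - _).
pose x (i : 'I_n.+2) := qint q i / qint q n.+1.
pose b (i : 'I_n.+2) := qbern q n.+1 i (\val a).
(* Writing the line as constant plus slope times node reduces the claim to the moments of order 0
   and 1. *)
transitivity (\sum_i (phi zero01 * b i + (phi one01 - phi zero01) * (x i * b i))).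
  rewrite big_split /= -!mulr_sumr sum_qbern// sum_qnode_qbern// endpoint_lineE.
  ring.
apply: eq_bigr => i _; rewrite endpoint_lineE /= -/(x i) -/(b i).
ring.
Qed.

Lemma nlbern_zero phi : L phi zero01 = `|phi zero01|.
Proof.
rewrite nlbernE big_ord_recl qnode0 big1 => [|i _].
  rewrite addr0 qbern0E// subr0 expr1n big1 ?invr1 ?mulr1// => j _.
  by rewrite mulr0 addr0.
by rewrite /qbern /bump /= exprS !(mul0r, mulr0).
Qed.

Lemma nlbern_one phi : L phi one01 = `|phi one01|.
Proof.
have b0 i : (i < n.+1)%N -> qbern q n.+1 i (\val (@one01 R)) = 0.
  by move=> i_n; rewrite /qbern /= subSn// exprS subrr !(mul0r, mulr0).
(* The last basis function is 1 at 1 because the others vanish there and all sum to 1; its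
   denominator need not be evaluated. *)
have := sum_qbern q_gt0 n.+1 one01.
rewrite big_ord_recr big1/= => [|i _]; last by rewrite b0.
rewrite add0r => b1; rewrite nlbernE big_ord_recr big1 => [|i _].
  by rewrite qnode_max /= b1 mulr1 add0r.
by rewrite b0 ?mulr0//=.
Qed.

Lemma nlbern_nonneg_ends phi : nonneg_ends (L phi).
Proof. by split; rewrite ?nlbern_zero ?nlbern_one. Qed.

Lemma nlbern_endpoint_line phi : nonneg_ends phi ->
  endpoint_line (L phi) = endpoint_line phi.
Proof.
by move=> [p0 p1]; apply: eq_endpoint_line; rewrite ?nlbern_zero ?nlbern_one ger0_norm.
Qed.

Lemma nlbern_contraction : exists2 r : R, 0 <= r < 1 &
  forall phi, nonneg_ends phi ->
    `|L phi - endpoint_line phi| <= r * `|phi - endpoint_line phi|.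
Proof.
have [c c0 cb] := qbern_ends_bound q_gt0 n.+1.
(* This makes the ratio [1 - c] nonnegative. The order [n.+1] is positive, so the two end terms are
   distinct terms of a sum equal to 1. *)
have c1 : c <= 1.
  rewrite (le_trans (cb zero01))// -(sum_qbern q_gt0 n.+1 zero01).
  rewrite big_ord_recl big_ord_recr /= lerD2l lerDr.
  by apply: sumr_ge0 => i _; exact: (qbern_ge0 q_gt0 _ _ zero01).
exists (1 - c); first by rewrite subr_ge0 c1 gtrBl.
move=> phi phi0; apply: supnorm_le => a.
rewrite C01_addE C01_oppE nlbern_endpoint_line_sub.
rewrite big_ord_recl big_ord_recr.
have [p0 p1] := phi0.
have -> : lift ord0 ord_max = ord_max :> 'I_n.+2 by exact/val_inj.
rewrite qnode0 qnode_max endpoint_line_zero endpoint_line_one.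
rewrite (ger0_norm p0) (ger0_norm p1) !subrr !mul0r /= add0r addr0.
apply: le_trans (ler_norm_sum _ _ _) _.
pose N := `|phi - endpoint_line phi|.
apply: le_trans (_ : \sum_(i < n) N * qbern q n.+1 i.+1 (\val a) <= _).
  apply: ler_sum => i _; rewrite /= /bump /= add1n normrM.
  rewrite (ger0_norm (qbern_ge0 _ _ _ _))// ler_wpM2r ?qbern_ge0//.
  (* The line is nonnegative, hence equal to its absolute value, and the reverse triangle inequality
     applies. *)
  set x := qnode _ _; have l0 := endpoint_line_ge0 x phi0.
  rewrite -{1}(ger0_norm l0) (le_trans (ler_dist_dist _ _))//.
  exact: (supnorm_ge (phi - endpoint_line phi) x).
rewrite -mulr_sumr mulrC ler_wpM2r ?normr_ge0//.
(* The interior weights sum to 1 minus the two end weights, hence to at most [1 - c]. *)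
have := sum_qbern q_gt0 n.+1 a; have := cb a.
rewrite big_ord_recl big_ord_recr /= /bump /= !add1n.
by under eq_bigr do rewrite add1n; lra.
Qed.

Lemma nlbern_iter_bound : exists2 r : R, 0 <= r < 1 &
  forall phi j, nonneg_ends phi ->
    `|iter j L phi - endpoint_line phi| <= r ^+ j * `|phi - endpoint_line phi|.
Proof.
have [r r01 rL] := nlbern_contraction; exists r => // phi j.
elim: j phi => [|j IHj] phi phi0; first by rewrite expr0 mul1r.
(* Since [phi] and [L phi] have the same interpolant, the induction hypothesis at [L phi] has the
   right target. *)
rewrite iterSr -(nlbern_endpoint_line phi0) exprSr -mulrA.
apply: (le_trans (IHj _ (nlbern_nonneg_ends phi))).
rewrite nlbern_endpoint_line// ler_wpM2l ?rL// exprn_ge0//.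
by case/andP: r01.
Qed.

Lemma nlbern_iter_cvg phi : nonneg_ends phi ->
  iter j L phi @[j --> \oo] --> endpoint_line phi.
Proof.
move=> phi0; have [r /andP[r0 r1] rL] := nlbern_iter_bound.
have rN : r ^+ j * `|phi - endpoint_line phi| @[j --> \oo] --> (0 : R).
  rewrite -(mul0r `|phi - endpoint_line phi|); apply: cvgMr_tmp.
  by apply: cvg_expr; rewrite ger0_norm.
move/cvgrPdist_le in rN; apply/cvgrPdist_le => e e0; near=> j.
rewrite distrC (le_trans (rL phi j phi0))// (le_trans (ler_norm _))//.
by rewrite -normrN -sub0r; near: j; exact: rN.
Unshelve. all: by end_near. Qed.

(** The line is its own interpolant, so the contraction bound at the line is 0. *)
Lemma nlbern_line_fixed phi : nonneg_ends phi ->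
  L (endpoint_line phi) = endpoint_line phi.
Proof.
move=> phi0; have [r _ rL] := nlbern_contraction.
have ll : endpoint_line (endpoint_line phi) = endpoint_line phi.
  by apply: eq_endpoint_line; rewrite ?endpoint_line_zero ?endpoint_line_one.
have l0 : nonneg_ends (endpoint_line phi) by split; exact: endpoint_line_ge0.
by have := rL _ l0; rewrite ll subrr normr0 mulr0 normr_le0 subr_eq0 => /eqP.
Qed.

End nlbern_iterates.

Theorem corollary4p1 (R : realType) (q : R) (q_gt0 : 0 < q)
    (n : nat) (n_gt0 : (0 < n)%N) :
  (forall phi : C01 R,
     cvg (iter j (nlbern q_gt0 n) phi @[j --> \oo]) /\
     [set phis : C01 R | nlbern q_gt0 n phis = phis]
       (lim (iter j (nlbern q_gt0 n) phi @[j --> \oo]))) /\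
  (forall phi : C01 R, nonneg_ends phi ->
     forall a : I01 R,
       iter j (nlbern q_gt0 n) phi a @[j --> \oo] -->
         phi zero01 * (1 - \val a) + phi one01 * \val a).
Proof.
case: n n_gt0 => [//|m _]; split=> [phi|phi phi0 a].
  have phi1 := nlbern_nonneg_ends q_gt0 m phi.
  have cv : iter j (nlbern q_gt0 m.+1) phi @[j --> \oo] -->
      endpoint_line (nlbern q_gt0 m.+1 phi).
    (* Dropping the first iterate leaves the iterates of [L phi], whose endpoint values are
       nonnegative for every [phi]. *)
    rewrite -cvg_shiftS/=; under eq_fun do rewrite -iterS iterSr.
    exact: nlbern_iter_cvg.
  split; first by apply/cvg_ex; eexists; exact: cv.
  by rewrite (cvg_lim _ cv)//= nlbern_line_fixed.
have /cvgrPdist_le cv := nlbern_iter_cvg q_gt0 m phi0.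
apply/cvgrPdist_le => e e0; near=> j.
(* Pointwise convergence follows from convergence in supremum norm. *)
apply: le_trans (_ : `|endpoint_line phi - iter j (nlbern q_gt0 m.+1) phi| <= e).
  exact: (supnorm_ge (endpoint_line phi - iter j (nlbern q_gt0 m.+1) phi) a).
by near: j; exact: cv.
Unshelve. all: by end_near. Qed.
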